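(* Let $f:\mathcal X\to\mathbb R$ be bounded and measurable, let $N\ge1$ be an integer, and for each $\beta\in[0,1]$ let $\tilde P_{\beta f}$ be a probability distribution on $\mathcal X$ (produced by some sampling algorithm). Consider the estimator: sample $\beta_1,\dots,\beta_N\sim\mathcal U([0,1])$ independently, draw $X_i\sim\tilde P_{\beta_i f}$ independently, and output $\tilde L_f=\frac1N\sum_{i=1}^Nf(X_i)$. Then for $\delta>0$, with probability at least $1-\delta$, \[|\tilde L_f-L_f|\le|L_f-\mathbb E\tilde L_f|+2\|f\|_\infty\sqrt{\frac{\log(2/\delta)}{2N}},\] where $|L_f-\mathbb E\tilde L_f|\le2\|f\|_\infty\sup_{\beta\in[0,1]}D_{\mathrm{TV}}(P_{\beta f},\tilde P_{\beta f})$ and, if $f$ is Lipschitz, $|L_f-\mathbb E\tilde L_f|\le|f|_1\sup_{\beta\in[0,1]}W_1(P_{\beta f},\tilde P_{\beta f})$.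
   Context: $\mathcal X=[0,1]^d$ with Lebesgue measure. For bounded measurable $h$: $Z_h=\int_{\mathcal X}e^h dx$, $L_h=\log Z_h$, $P_h$ the distribution with density $e^h/Z_h$. $|f|_1$ is the minimal Lipschitz constant of $f$ with respect to the Euclidean norm. $D_{\mathrm{TV}}(P,Q)=\sup_A|P(A)-Q(A)|$, $W_1(P,Q)=\inf_{X\sim P,Y\sim Q}\mathbb E\|X-Y\|_2$. $\|f\|_\infty$ is the essential supremum of $|f|$.
   Formalization: ‖f‖_∞ is taken as the supremum of |f| over the cube, not the essential supremum, since the bounds fail when the sampling distribution charges a Lebesgue-null set; β ↦ P̃_{βf}(B) is assumed measurable so that the two-stage sampling is defined. *)

(* Defs.v *)
From HB Require Import structures.
From mathcomp Require Import all_boot all_order all_algebra.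
From mathcomp Require Import all_classical all_reals all_analysis.
From mathcomp Require Import measurable_realfun.
Set Implicit Arguments.
Unset Strict Implicit.
Unset Printing Implicit Defensive.
Import Order.TTheory GRing.Theory Num.Theory.
Local Open Scope classical_set_scope.
Local Open Scope ring_scope.

Section defs.
Context {R : realType} {d : nat}.
Local Notation pt := (d.-tuple R).

(* The cube X = [0,1]^d, points of R^d being d-tuples (product sigma-algebra). *)
Definition cube : set pt := [set x | forall i : 'I_d, 0 <= tnth x i <= 1].

Definition box (a b : 'I_d -> R) : set pt :=
  [set x | forall i : 'I_d, a i <= tnth x i <= b i].

(* mu is the d-dimensional Lebesgue measure (on the product Borel sigma-algebra):
   it gives every box its volume; this determines mu uniquely. *)
Definition is_lebesgue_Rd (mu : {measure set pt -> \bar R}) : Prop :=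
  forall a b : 'I_d -> R, (forall i, a i <= b i) ->
    mu (box a b) = (\prod_(i < d) (b i - a i))%:E.

Definition eucl (x y : pt) : R :=
  Num.sqrt (\sum_(i < d) (tnth x i - tnth y i) ^+ 2).

Definition Zpart (mu : {measure set pt -> \bar R}) (h : pt -> R) : R :=
  fine (\int[mu]_(x in cube) (expR (h x))%:E).
Definition Lpart (mu : {measure set pt -> \bar R}) (h : pt -> R) : R :=
  ln (Zpart mu h).
Definition gibbs (mu : {measure set pt -> \bar R}) (h : pt -> R) : set pt -> \bar R :=
  fun A => ((\int[mu]_(x in A `&` cube) (expR (h x))%:E) * ((Zpart mu h)^-1)%:E)%E.

Definition dTV (P Q : set pt -> \bar R) : \bar R :=
  ereal_sup [set (`| P A - Q A |)%E | A in [set A : set pt | measurable A]].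

Definition coupling (P Q : set pt -> \bar R) (pi : probability (pt * pt)%type R) : Prop :=
  forall A : set pt, measurable A ->
    pi (A `*` setT) = P A /\ pi (setT `*` A) = Q A.
Definition W1 (P Q : set pt -> \bar R) : \bar R :=
  ereal_inf [set (\int[pi]_z (eucl z.1 z.2)%:E)%E | pi in coupling P Q].

Definition supnorm (f : pt -> R) : R := sup [set `| f x | | x in cube].

Definition lipschitz_on_cube (f : pt -> R) : Prop :=
  exists k : R, forall x y, cube x -> cube y -> `| f x - f y | <= k * eucl x y.
Definition lipconst (f : pt -> R) : R :=
  inf [set k : R | 0 <= k /\
        forall x y, cube x -> cube y -> `| f x - f y | <= k * eucl x y].
End defs.

Definition mutually_independent {R : realType} {dO dT : measure_display}
  {Omega : measurableType dO} {T : measurableType dT} {N : nat}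
  (P : probability Omega R) (Y : 'I_N -> Omega -> T) : Prop :=
  forall (J : {set 'I_N}) (B : 'I_N -> set T), (forall i, measurable (B i)) ->
    P (\bigcap_(i in [set i | i \in J]) (Y i @^-1` B i)) =
    (\prod_(i in J) P (Y i @^-1` B i))%E.

Definition unit_itv {R : realType} : set R := `[0, 1]%classic.

(* Main.v *)
Require Import Defs.
From HB Require Import structures.
From mathcomp Require Import all_boot all_order all_algebra.
From mathcomp Require Import all_classical all_reals all_analysis.
From mathcomp Require Import measurable_realfun.
From mathcomp Require Import ring lra.
Import Order.TTheory GRing.Theory Num.Theory.
Import numFieldNormedType.Exports.
Local Open Scope classical_set_scope.
Local Open Scope ring_scope.

(* Thermodynamic integration: the derivative of b |-> log Z_{bf} is the mean of f
   under P_{bf}, so L_f is the integral over b in [0,1] of these means, while the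
   expectation of the estimator is the integral of the means under Pt b. The bias
   is thus at most the supremum over b of the difference of the two means, which
   is controlled by total variation or by any coupling; the fluctuation around
   the expectation is controlled by Hoeffding's inequality.

   Positive linear functionals on bounded measurable functions that are eps-close
   on indicators are (c * eps)-close on functions with values in [0, c]. With
   eps > 0 this is the total variation bound; with eps = 0 it gives the changes
   of variables (marginals, mixtures) and, one coordinate at a time, the product
   formula for expectations of independent variables. *)

Set Implicit Arguments.
Unset Strict Implicit.
Unset Printing Implicit Defensive.

(** * Positive functionals on bounded measurable functions *)

(** The bound holds at every point, not almost everywhere, so that no measure is singled out: such a
    function is integrable against every finite measure and stays in the class under composition
    with a measurable map. *)
Definition bounded_measurable {R : realType} {dT : measure_display}
    {T : measurableType dT} (g : T -> R) : Prop :=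
  measurable_fun setT g /\ exists M : R, forall x, `|g x| <= M.

Section bounded_measurable.
Context {R : realType} {dT : measure_display} {T : measurableType dT}.
Implicit Types (g h : T -> R) (mu : {measure set T -> \bar R}).

Lemma bounded_measurable_cst (c : R) : @bounded_measurable R dT T (fun=> c).
Proof. by split; [exact: measurable_cst|exists `|c|]. Qed.

Lemma bounded_measurableD g h : bounded_measurable g -> bounded_measurable h ->
  bounded_measurable (fun x => g x + h x).
Proof.
move=> [mg [M gM]] [mh [L hL]]; split; first exact: measurable_funD.
by exists (M + L) => x; rewrite (le_trans (ler_normD _ _))// lerD.
Qed.

Lemma bounded_measurableM g h : bounded_measurable g -> bounded_measurable h ->
  bounded_measurable (fun x => g x * h x).
Proof.
move=> [mg [M gM]] [mh [L hL]]; split; first exact: measurable_funM.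
by exists (M * L) => x; rewrite normrM ler_pM.
Qed.

Lemma bounded_measurableZ (c : R) g : bounded_measurable g ->
  bounded_measurable (fun x => c * g x).
Proof. by apply: bounded_measurableM; exact: bounded_measurable_cst. Qed.

Lemma bounded_measurableN g : bounded_measurable g ->
  bounded_measurable (fun x => - g x).
Proof.
by move=> [mg [M gM]]; split; [exact: measurable_funN|exists M => x; rewrite normrN].
Qed.

Lemma bounded_measurableB g h : bounded_measurable g -> bounded_measurable h ->
  bounded_measurable (fun x => g x - h x).
Proof.
by move=> bg bh; apply: bounded_measurableD => //; exact: bounded_measurableN.
Qed.

Lemma bounded_measurable_expR g : bounded_measurable g ->
  bounded_measurable (fun x => expR (g x)).
Proof.
move=> [mg [M gM]]; split; first exact: measurableT_comp.
exists (expR M) => x; rewrite ger0_norm ?expR_ge0// ler_expR.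
exact: le_trans (ler_norm _) _.
Qed.

Lemma bounded_measurable_indic (A : set T) : measurable A ->
  bounded_measurable (\1_A : T -> R).
Proof.
move=> mA; split; first exact: measurable_indic.
by exists 1 => x; rewrite indicE normr_nat lern1 leq_b1.
Qed.

Lemma bounded_measurable_bigop (idx : R) (op : R -> R -> R) n
    (P : pred 'I_n) (G : 'I_n -> T -> R) :
  (forall g h, bounded_measurable g -> bounded_measurable h ->
    bounded_measurable (fun x => op (g x) (h x))) ->
  (forall i, bounded_measurable (G i)) ->
  bounded_measurable (fun x => \big[op/idx]_(i < n | P i) G i x).
Proof.
move=> bop bG; elim: (index_enum _) => [|i r IH].
  by under eq_fun do rewrite big_nil; exact: bounded_measurable_cst.
under eq_fun do rewrite big_cons.
by case: (P i) => //; exact: bop.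
Qed.

Lemma bounded_measurable_sum n (P : pred 'I_n) (G : 'I_n -> T -> R) :
  (forall i, bounded_measurable (G i)) ->
  bounded_measurable (fun x => \sum_(i < n | P i) G i x).
Proof. by apply: bounded_measurable_bigop; exact: bounded_measurableD. Qed.

Lemma bounded_measurable_prod n (P : pred 'I_n) (G : 'I_n -> T -> R) :
  (forall i, bounded_measurable (G i)) ->
  bounded_measurable (fun x => \prod_(i < n | P i) G i x).
Proof. by apply: bounded_measurable_bigop; exact: bounded_measurableM. Qed.

Lemma bounded_measurable_comp {dS : measure_display} {S : measurableType dS}
    (phi : S -> T) g : measurable_fun setT phi -> bounded_measurable g ->
  bounded_measurable (fun x => g (phi x)).
Proof.
move=> mphi [mg [M gM]]; split; first exact: measurableT_comp.
by exists M => x.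
Qed.

Lemma bounded_measurable_integrable mu (D : set T) g : measurable D ->
  (mu D < +oo)%E -> bounded_measurable g -> mu.-integrable D (EFin \o g).
Proof.
move=> mD muD [mg [M gM]]; apply: measurable_bounded_integrable => //.
  exact: measurable_funS mg.
exists M; split; first exact: num_real.
by move=> N MN x _; exact: le_trans (gM x) (ltW MN).
Qed.

End bounded_measurable.

(** No countable additivity or monotone convergence is asked: uniform approximation by combinations
    of indicators works with linearity and positivity alone. *)
Record positive_functional {R : realType} {dT : measure_display}
    {T : measurableType dT} (I : (T -> R) -> R) : Prop := PositiveFunctional {
  pfunD : forall g h, bounded_measurable g -> bounded_measurable h ->
    I (fun x => g x + h x) = I g + I h ;
  pfunZ : forall (c : R) g, bounded_measurable g ->
    I (fun x => c * g x) = c * I g ;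
  pfun_ge0 : forall g, bounded_measurable g -> (forall x, 0 <= g x) -> 0 <= I g }.

Section positive_functional.
Context {R : realType} {dT : measure_display} {T : measurableType dT}.
Implicit Types (g h : T -> R) (I : (T -> R) -> R).

Lemma pfun_le I g h : positive_functional I ->
  bounded_measurable g -> bounded_measurable h ->
  (forall x, g x <= h x) -> I g <= I h.
Proof.
move=> pI bg bh gh.
have -> : h = (fun x => g x + (h x - g x)).
  by apply/funext => x; rewrite addrC subrK.
have bhg := bounded_measurableB bh bg.
rewrite (pfunD pI)// lerDl (pfun_ge0 pI)// => x.
by rewrite subr_ge0.
Qed.

Lemma pfun_sum I n (G : 'I_n -> T -> R) : positive_functional I ->
  (forall i, bounded_measurable (G i)) ->
  I (fun x => \sum_(i < n) G i x) = \sum_(i < n) I (G i).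
Proof.
move=> pI; elim: n G => [|n IH] G bG.
  under eq_fun do rewrite big_ord0.
  have := pfunZ pI 0 (bounded_measurable_cst 0).
  by rewrite big_ord0; under eq_fun do rewrite mul0r; rewrite mul0r.
under eq_fun do rewrite big_ord_recr /=.
rewrite (pfunD pI) ?IH ?big_ord_recr//.
exact: bounded_measurable_sum.
Qed.

(** The sum counts the integers from 1 to n that are at most y, so it is the integer part of y. *)
Lemma staircase (n : nat) (y : R) : 0 <= y <= n%:R ->
  y - 1 <= \sum_(k < n) (k.+1%:R <= y)%R%:R <= y.
Proof.
elim: n y => [|n IH] y; first by rewrite big_ord0; lra.
rewrite big_ord_recr/= => /andP[y0 yn].
have [n1y|yn1] := leP n.+1%:R y.
  have -> : y = n.+1%:R by apply/eqP; rewrite eq_le yn n1y.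
  under eq_bigr => i _ do rewrite ler_nat ltnS (ltnW (ltn_ord i)).
  rewrite sumr_const card_ord -[in X in _ <= X <= _]natrD addn1.
  by rewrite lexx andbT gerBl.
rewrite addr0; have [yn'|ny] := leP y n%:R.
  by apply: IH; rewrite y0.
under eq_bigr => i _ do rewrite (le_trans _ (ltW ny)) ?ler_nat ?ltn_ord//.
rewrite sumr_const card_ord -[_ *+ n]/(n%:R); move: yn1; rewrite -natr1; lra.
Qed.

(* A function with values in [0, c] is uniformly approximated by the average of
   the n multiples c * \1_{g >= c (k+1) / n} of indicators. *)
Lemma pfun_close I J (eps c : R) g :
  positive_functional I -> positive_functional J ->
  (forall A, measurable A -> `|I \1_A - J \1_A| <= eps) ->
  measurable_fun setT g -> (forall x, 0 <= g x <= c) ->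
  `|I g - J g| <= c * eps.
Proof.
move=> pI pJ IJ mg gc.
have bg : bounded_measurable g.
  split=> //; exists c => x.
  by have /andP[g0 gcx] := gc x; rewrite ger0_norm.
(* The type is pointed, so g takes at least one value in [0, c]. *)
have c0 : 0 <= c by have /andP[+ +] := gc point; exact: le_trans.
have [c_eq0|cN0] := eqVneq c 0.
  rewrite c_eq0 mul0r; suff -> : g = (fun x => 0 * g x).
    by rewrite (pfunZ pI)// (pfunZ pJ)// !mul0r subrr normr0.
  apply/funext => x; rewrite mul0r; apply/eqP; rewrite eq_le andbC.
  by have := gc x; rewrite c_eq0.
have cp : 0 < c by rewrite lt_neqAle eq_sym cN0.
(* Replacing g by the step function [h] costs at most c / (n + 1) times the total mass under each
   functional. *)
have step (n : nat) : `|I g - J g| <= c * eps + c * (I (fun=> 1) + J (fun=> 1)) / n.+1%:R.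
  pose G (k : 'I_n.+1) : set T := [set x | k.+1%:R <= n.+1%:R / c * g x].
  pose h x := \sum_(k < n.+1) c / n.+1%:R * \1_(G k) x : R.
  have mG k : measurable (G k).
    have -> : G k = setT `&` (fun x => n.+1%:R / c * g x) @^-1` `[k.+1%:R, +oo[.
      by rewrite setTI; apply/seteqP; split => x /=; rewrite in_itv/= andbT.
    have : measurable_fun setT (fun x => n.+1%:R / c * g x) by exact: measurable_funM.
    by apply.
  have bG k : bounded_measurable (\1_(G k) : T -> R) by exact: bounded_measurable_indic.
  have bcG k : bounded_measurable (fun x => c / n.+1%:R * \1_(G k) x : R).
    exact: bounded_measurableZ.
  have bh : bounded_measurable h by exact: bounded_measurable_sum.
  have gh x : 0 <= g x - h x <= c / n.+1%:R.
    have cn0 : 0 < c / n.+1%:R by rewrite divr_gt0.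
    set y := n.+1%:R / c * g x.
    have gy : g x = c / n.+1%:R * y.
      by rewrite /y -[c / _]invf_div mulKf// mulf_neq0 ?invr_eq0 ?pnatr_eq0.
    have hy : h x = c / n.+1%:R * \sum_(k < n.+1) (k.+1%:R <= y)%R%:R.
      rewrite mulr_sumr; apply: eq_bigr => k _; rewrite indicE; congr (_ * _%:R).
      by rewrite /G -/y; case: leP => ky; [rewrite mem_set|rewrite memNset//= -/y leNgt ky].
    have : 0 <= y <= n.+1%:R.
      have /andP[g0 gcx] := gc x.
      rewrite mulr_ge0 ?divr_ge0//= /y mulrAC ler_pdivrMr// ler_wpM2l//.
    move=> /staircase; rewrite hy gy -mulrBr; set S := \sum_(_ < _) _.
    move=> /andP[yS Sy]; rewrite mulr_ge0 ?subr_ge0 ?(ltW cn0)//=.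
    by rewrite ger_pMr//; lra.
  have close K : positive_functional K -> 0 <= K g - K h <= c / n.+1%:R * K (fun=> 1).
    move=> pK; have -> : K g = K h + K (fun x => g x - h x).
      rewrite -(pfunD pK)//; last exact: bounded_measurableB.
      by congr K; apply/funext => x; rewrite addrC subrK.
    have bgh := bounded_measurableB bg bh.
    rewrite addrC addKr (pfun_ge0 pK)//=; last by move=> x; have /andP[] := gh x.
    rewrite -(pfunZ pK); last exact: bounded_measurable_cst.
    apply: (pfun_le pK) => //; last by move=> x; rewrite mulr1; have /andP[] := gh x.
    by apply: bounded_measurableZ; exact: bounded_measurable_cst.
  (* Each of the n + 1 indicators contributes at most eps, with weight c / (n + 1). *)
  have hIJ : `|I h - J h| <= c * eps.
    rewrite !pfun_sum// -sumrB (le_trans (ler_norm_sum _ _ _))//.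
    under eq_bigr do rewrite (pfunZ pI)// (pfunZ pJ)// -mulrBr normrM.
    apply: (@le_trans _ _ (\sum_(i < n.+1) (c / n.+1%:R) * eps)).
      apply: ler_sum => i _; rewrite ger0_norm ?divr_ge0//.
      by rewrite ler_wpM2l ?divr_ge0// IJ.
    rewrite sumr_const card_ord -[leLHS]mulr_natr mulrAC -[_ / _ * _]mulrA.
    by rewrite mulVf ?pnatr_eq0// mulr1.
  have := close _ pI; have := close _ pJ; move: hIJ.
  rewrite mulrDr mulrDl ![c * _ / _]mulrAC !ler_norml.
  move: (c / _ * _) (c / _ * _) => a b; lra.
(* The extra term tends to 0 as n grows, so it can be made smaller than any e > 0. *)
apply/ler_addgt0Pr => e e0.
set K := c * (_ + _) in step.
have [n nK] : exists n : nat, K / n.+1%:R <= e.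
  exists (Num.truncn (K / e)).
  rewrite ler_pdivrMr// mulrC -ler_pdivrMr// ltW//.
  exact: truncnS_gt.
by rewrite (le_trans (step n))// lerD2l.
Qed.

End positive_functional.

Section positive_functional_norm.
Context {R : realType} {dT : measure_display} {T : measurableType dT}.
Implicit Types (g : T -> R) (I J : (T -> R) -> R).

(** Adding M moves the values of g into [0, 2M], where [pfun_close] applies; the shift cancels in
    the difference because I and J have the same total mass. *)
Lemma pfun_close_norm I J (eps M : R) g :
  positive_functional I -> positive_functional J -> I (fun=> 1) = J (fun=> 1) ->
  (forall A, measurable A -> `|I \1_A - J \1_A| <= eps) ->
  measurable_fun setT g -> (forall x, `|g x| <= M) ->
  `|I g - J g| <= 2 * M * eps.
Proof.
move=> pI pJ IJ1 IJ mg gM.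
have bg : bounded_measurable g by split=> //; exists M.
have bM : bounded_measurable (fun=> M * 1 : R) := bounded_measurable_cst (T := T) (M * 1).
have shift K : positive_functional K ->
    K g = K (fun x => g x + M * 1) - M * K (fun=> 1).
  move=> pK; rewrite (pfunD pK)// (pfunZ pK) ?addrK//.
  exact: bounded_measurable_cst.
rewrite (shift _ pI) (shift _ pJ) IJ1 opprB addrA subrK.
apply: pfun_close => //; first by have [] := bounded_measurableD bg bM.
by move=> x; have := gM x; rewrite ler_norml; lra.
Qed.

Lemma pfun_eq I J g : positive_functional I -> positive_functional J ->
  (forall A, measurable A -> I \1_A = J \1_A) ->
  bounded_measurable g -> I g = J g.
Proof.
move=> pI pJ IJ [mg [M gM]]; apply/eqP; rewrite -subr_eq0 -normr_le0.
rewrite -(mulr0 (2 * M)); apply: pfun_close_norm => //.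
  by have := IJ setT measurableT; rewrite indicT.
by move=> A mA; rewrite IJ// subrr normr0.
Qed.

Lemma pfunZr I (c : R) : 0 <= c -> positive_functional I ->
  positive_functional (fun g => I g * c).
Proof.
move=> c0 pI; split=> [g h bg bh|a g bg|g bg g0].
- by rewrite (pfunD pI)// mulrDl.
- by rewrite (pfunZ pI)// mulrA.
- by rewrite mulr_ge0// (pfun_ge0 pI).
Qed.

End positive_functional_norm.

(** * Integrals as positive functionals *)

Section integral_functional.
Context {R : realType} {dS dT : measure_display}.
Context {S : measurableType dS} {T : measurableType dT}.

(** The weight [w] will be a Gibbs density, or the product of the remaining factors in an
    expectation of independent variables. *)
Lemma positive_functional_Rintegral (mu : {measure set S -> \bar R}) (D : set S)
    (phi : S -> T) (w : S -> R) : measurable D -> (mu D < +oo)%E ->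
  measurable_fun setT phi -> bounded_measurable w -> (forall x, 0 <= w x) ->
  positive_functional (fun g => \int[mu]_(x in D) (g (phi x) * w x)).
Proof.
move=> mD muD mphi bw w0.
have int g : bounded_measurable g ->
    mu.-integrable D (EFin \o (fun x => g (phi x) * w x)).
  move=> bg; apply: bounded_measurable_integrable => //.
  by apply: bounded_measurableM => //; exact: bounded_measurable_comp bg.
split=> [g h bg bh|c g bg|g bg g0].
- rewrite -RintegralD//; [|exact: int..].
  by apply: eq_Rintegral => x _; rewrite mulrDl.
- rewrite -RintegralZl//; last exact: int.
  by apply: eq_Rintegral => x _; rewrite mulrA.
- by apply: Rintegral_ge0 => x _; rewrite mulr_ge0.
Qed.

Lemma positive_functional_expectation (mu : {measure set S -> \bar R})
    (phi : S -> T) : (mu setT < +oo)%E -> measurable_fun setT phi ->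
  positive_functional (fun g => \int[mu]_x (g (phi x))).
Proof.
move=> muT mphi.
have : positive_functional (fun g : T -> R => \int[mu]_x (g (phi x) * 1)).
  apply: positive_functional_Rintegral => //; exact: bounded_measurable_cst.
congr positive_functional; apply/funext => g.
by apply: eq_Rintegral => x _; rewrite mulr1.
Qed.

Lemma Rintegral_indic (mu : {measure set S -> \bar R}) (D A : set S) :
  measurable D -> measurable A ->
  \int[mu]_(x in D) (\1_A x) = fine (mu (A `&` D)).
Proof. by move=> mD mA; rewrite /Rintegral integral_indic. Qed.

Lemma Rintegral_indic_comp (mu : {measure set S -> \bar R}) (phi : S -> T)
    (A : set T) : measurable_fun setT phi -> measurable A ->
  \int[mu]_x (\1_A (phi x)) = fine (mu (phi @^-1` A)).
Proof.
move=> mphi mA; have -> : (fun x => \1_A (phi x)) = \1_(phi @^-1` A) :> (S -> R).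
  by apply/funext => x; rewrite !indicE.
by rewrite Rintegral_indic ?setIT// -[X in measurable X]setTI; exact: mphi.
Qed.

End integral_functional.

(** * Expectation of a product of independent factors *)

Section independence.
Context {R : realType} {dO dT : measure_display}.
Context {Omega : measurableType dO} {T : measurableType dT} {N : nat}.
Variables (P : probability Omega R) (Y : 'I_N -> Omega -> T).
Hypothesis mY : forall i, measurable_fun setT (Y i).
Hypothesis indepY : mutually_independent P Y.

Let Pfin : (P setT < +oo)%E.
Proof. by rewrite probability_setT ltry. Qed.

Let bY g i : bounded_measurable g ->
  bounded_measurable (fun w => g (Y i w) : R).
Proof. by move=> bg; exact: bounded_measurable_comp bg. Qed.

(** The product of the indicators is the indicator of the joint event, so this is [indepY] for the
    full index set. *)
Let expectation_prod_indic (B : 'I_N -> set T) : (forall i, measurable (B i)) ->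
  \int[P]_w (\prod_(i < N) (\1_(B i) (Y i w) : R)) =
  \prod_(i < N) \int[P]_w (\1_(B i) (Y i w)).
Proof.
move=> mB.
have mYB i : measurable (Y i @^-1` B i) by rewrite -[X in measurable X]setTI; exact: mY.
have := indepY [set: 'I_N]%SET mB; set C := (X in P X) => PC.
have -> : (fun w => \prod_(i < N) \1_(B i) (Y i w)) = \1_C :> (Omega -> R).
  apply/funext => w; rewrite indicE.
  have [H|H] := pselect (forall i, B i (Y i w)).
    rewrite mem_set => [|i _]; last exact: H.
    by apply: big1 => i _; rewrite indicE mem_set.
  rewrite memNset; last by move=> H'; apply: H => i; apply: H'; rewrite /= finset.in_setT.
  move/existsNP : H => [i Hi].
  by rewrite (bigD1 i)//= indicE memNset// mul0r.
rewrite Rintegral_indic//; last first.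
  by apply: fin_bigcap_measurable => // ; exact: finite_finset.
rewrite setIT; apply: (etrans (congr1 fine PC)).
under [RHS]eq_bigr do rewrite Rintegral_indic_comp//.
transitivity (fine (\prod_(i < N) P (Y i @^-1` B i))%E).
  by congr fine; apply: eq_bigl => i; exact: finset.in_setT.
rewrite (eq_bigr (fun i => (fine (P (Y i @^-1` B i)))%:E)) => [|i _];
  last by rewrite fineK// fin_num_measure.
by rewrite prodEFin.
Qed.

(* Replace the indicators by arbitrary functions one coordinate at a time: both
   sides are positive functionals of the k-th factor. *)
Lemma expectation_prod (g : 'I_N -> T -> R) :
  (forall i, bounded_measurable (g i)) -> (forall i x, 0 <= g i x) ->
  \int[P]_w (\prod_(i < N) g i (Y i w)) = \prod_(i < N) \int[P]_w g i (Y i w).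
Proof.
(* Induction on the number k of leading factors that are arbitrary, those of index at least k being
   indicators; k = N leaves no constraint. *)
suff H k : forall g : 'I_N -> T -> R, (k <= N)%N ->
    (forall i, bounded_measurable (g i)) -> (forall i x, 0 <= g i x) ->
    (forall i : 'I_N, (k <= i)%N -> exists2 B, measurable B & g i = \1_B) ->
    \int[P]_w (\prod_(i < N) g i (Y i w)) = \prod_(i < N) \int[P]_w g i (Y i w).
  move=> bg g0; apply: (H N) => // i; by rewrite leqNgt ltn_ord.
elim: k => [|k IH] {}g kN bg g0 gind.
  have /choice[B HB] : forall i, exists B, measurable B /\ g i = \1_B.
    by move=> i; have [B mB gB] := gind i (leq0n _); exists B.
  have -> : g = (fun i => \1_(B i)) by apply/funext => i; have [] := HB i.
  by apply: expectation_prod_indic => i; have [] := HB i.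
pose j := Ordinal kN.
under eq_Rintegral do rewrite (bigD1 j)//=.
rewrite [RHS](bigD1 j)//=.
apply: (@pfun_eq R dT T
  (fun h => \int[P]_w (h (Y j w) * \prod_(i < N | i != j) g i (Y i w)))
  (fun h => \int[P]_w h (Y j w) * \prod_(i < N | i != j) \int[P]_w g i (Y i w))) => //.
- apply: positive_functional_Rintegral => //.
    by apply: bounded_measurable_prod => i; exact: bY.
  by move=> w; apply: prodr_ge0.
- apply: pfunZr; last exact: positive_functional_expectation.
  by apply: prodr_ge0 => i _; apply: Rintegral_ge0.
- move=> A mA.
  (* With an indicator at index j = k, only the first k factors remain arbitrary, and the induction
     hypothesis applies to [h]. *)
  pose h i := if i == j then \1_A else g i.
  have hj : h j = \1_A by rewrite /h eqxx.
  have hi i : i != j -> h i = g i by rewrite /h => /negPf ->.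
  have := IH h (ltnW kN); rewrite (bigD1 j)//= hj.
  rewrite (eq_bigr (fun i => \int[P]_w g i (Y i w))) => [<-|i ij]; last by rewrite hi.
  - apply: eq_Rintegral => w _; rewrite [RHS](bigD1 j)//= hj; congr (_ * _).
    by apply: eq_bigr => i ij; rewrite hi.
  - by move=> i; rewrite /h; case: eqP => // _; exact: bounded_measurable_indic.
  - by move=> i x; rewrite /h; case: eqP => // _; rewrite indicE.
  - move=> i; rewrite leq_eqVlt => /predU1P[ki|]; last first.
      by move=> ki; rewrite hi; [exact: gind|apply: contraTneq ki => ->; rewrite ltnn].
    by exists A => //; rewrite (_ : i = j) ?hj//; exact: val_inj.
Qed.

End independence.

(** * Hoeffding's inequality *)

Section hoeffding_analytic.
Context {R : realType}.
Implicit Types p u s y M : R.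

Lemma is_derive_ge0_le (f f' : R -> R) : (forall x : R, is_derive x 1 f (f' x)) ->
  (forall x, 0 < x -> 0 <= f' x) -> forall u, 0 <= u -> f 0 <= f u.
Proof.
move=> df f'0 u; rewrite le_eqVlt => /predU1P[<-//|u0].
have cf : {within `[0, u], continuous f}.
  apply: continuous_subspaceT => x; apply: differentiable_continuous.
  by apply/derivable1_diffP; have [] := df x.
have [z] := MVT u0 (fun z _ => df z) cf.
rewrite in_itv/= => /andP[z0 _] fu.
by rewrite -subr_ge0 fu mulr_ge0 ?f'0// subr0 ltW.
Qed.

(** [A p] is the moment generating function of a random sign that equals 1 with probability p. With
    [B] below, A' = B and B' = A. *)
Let A p u := p * expR u + (1 - p) * expR (- u).
Let B p u := p * expR u - (1 - p) * expR (- u).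

Let A_gt0 p u : 0 <= p <= 1 -> 0 < A p u.
Proof.
move=> p01; rewrite /A.
have := expR_gt0 u; have := expR_gt0 (- u); move: (expR u) (expR _) => a b; nra.
Qed.

Let dA p u : is_derive u 1 (A p) (B p u).
Proof.
rewrite /A; apply: is_derive_eq.
by rewrite /B /GRing.scale/=; ring.
Qed.

(** The expression vanishes at u = 0, and its derivative is 1 - (A^2 - B^2) / A^2 = (B / A)^2. *)
Let slope_ge0 p u : 0 <= p <= 1 -> 0 <= u -> 0 <= u + (2 * p - 1) - B p u / A p u.
Proof.
move=> p01 u0.
have A0 x : A p x != 0 by rewrite gt_eqF// A_gt0.
pose h (x : R) := x + (2 * p - 1) - B p x / A p x.
have <- : h 0 = 0 by rewrite /h /A /B oppr0 expR0; field; lra.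
apply: (@is_derive_ge0_le h (fun x => (B p x / A p x) ^+ 2)) => // [x|x _]; last first.
  exact: sqr_ge0.
have dV : is_derive x 1 (fun y => (A p y)^-1) (- (A p x) ^- 2 *: B p x).
  exact: is_deriveV.
rewrite /h; apply: is_derive_eq; rewrite /GRing.scale/=.
have -> : p * expR x - (1 - p) * (expR (- x) * -1) = A p x by rewrite /A; ring.
by field.
Qed.

(** Take logarithms: the exponent on the right minus ln A vanishes at 0, and its derivative is the
    quantity of [slope_ge0]. *)
Let chernoff_bernoulli_ge0 p u : 0 <= p <= 1 -> 0 <= u ->
  p * expR u + (1 - p) * expR (- u) <= expR ((2 * p - 1) * u + u ^+ 2 / 2).
Proof.
move=> p01 u0; rewrite -[leLHS]lnK ?posrE ?A_gt0// ler_expR -subr_ge0.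
pose h (x : R) := (2 * p - 1) * x + x ^+ 2 / 2 - ln (A p x).
have h0 : h 0 = 0.
  rewrite /h /A oppr0 expR0 !mulr1 addrC [p + _]addrC subrK ln1; ring.
suff : h 0 <= h u by rewrite h0.
apply: (@is_derive_ge0_le h (fun x => x + (2 * p - 1) - B p x / A p x)) => [x|x x0|].
- have dln : is_derive x 1 (fun y => ln (A p y)) ((A p x)^-1 *: B p x).
    have dlnA := is_derive1_ln (A_gt0 x p01).
    exact: (@is_derive1_comp _ (@ln R) (A p) x _ _ dlnA (dA p x)).
  rewrite /h; apply: is_derive_eq.
  by rewrite /GRing.scale/=; field; rewrite gt_eqF// A_gt0.
- by apply: slope_ge0 => //; exact: ltW.
- exact: u0.
Qed.

(** Both sides are unchanged when p becomes 1 - p and u becomes -u, which reduces the claim to u >=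
    0. *)
Lemma chernoff_bernoulli p u : 0 <= p <= 1 ->
  p * expR u + (1 - p) * expR (- u) <= expR ((2 * p - 1) * u + u ^+ 2 / 2).
Proof.
move=> p01; have [u0|u0] := leP 0 u; first exact: chernoff_bernoulli_ge0.
have : 0 <= 1 - p <= 1 by lra.
move=> /(@chernoff_bernoulli_ge0 (1 - p) (- u)); rewrite oppr_ge0 => /(_ (ltW u0)).
rewrite opprK subKr addrC => /le_trans; apply.
by rewrite ler_expR le_eqVlt; apply/orP; left; apply/eqP; field.
Qed.

(** Convexity: the tangent of the exponential at [s * y] lies below it at both ends [s * M] and
    [- (s * M)]. Averaging with weights l and 1 - l cancels the linear terms, since [s * y] is the
    matching barycentre. *)
Lemma expR_chord s y M : 0 < M -> `|y| <= M ->
  expR (s * y) <= (M + y) / (2 * M) * expR (s * M) +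
                  (1 - (M + y) / (2 * M)) * expR (- (s * M)).
Proof.
move=> M0 yM; have {yM} : - M <= y <= M by rewrite -ler_norml.
move=> /andP[My yM].
set l := (M + y) / (2 * M).
have l01 : 0 <= l <= 1 by rewrite /l divr_ge0 ?ler_pdivrMr//=; lra.
have tangent a : expR (s * y) * (1 + (a - s * y)) <= expR a.
  rewrite -[in leRHS](subrK (s * y) a) [in leRHS]expRD mulrC.
  by rewrite ler_wpM2r ?expR_ge0// expR_ge1Dx.
have := tangent (s * M); have := tangent (- (s * M)).
have sy : s * y = (2 * l - 1) * (s * M) by rewrite /l; field; lra.
have := expR_gt0 (s * y); move: (expR _) (expR _) (expR _) => a b e e0.
have : (1 + (- (s * M) - s * y)) * (1 - l) + (1 + (s * M - s * y)) * l = 1.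
  by rewrite sy; ring.
move: (1 + (- (s * M) - s * y)) (1 + (s * M - s * y)) => c d cd1 hb ha.
have -> : e = (e * c) * (1 - l) + (e * d) * l by rewrite -!mulrA -mulrDr cd1 mulr1.
have hb' : e * c * (1 - l) <= b * (1 - l) by rewrite ler_wpM2r//; lra.
have ha' : e * d * l <= a * l by rewrite ler_wpM2r//; lra.
lra.
Qed.

End hoeffding_analytic.

Section hoeffding_upper.
Context {R : realType} {dO dT : measure_display}.
Context {Omega : measurableType dO} {T : measurableType dT} {N : nat}.
Variables (P : probability Omega R) (Y : 'I_N -> Omega -> T).
Hypothesis mY : forall i, measurable_fun setT (Y i).
Hypothesis indepY : mutually_independent P Y.
Variables (g : T -> R) (M : R).
Hypotheses (mg : measurable_fun setT g) (M0 : 0 < M) (gM : forall x, `|g x| <= M).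

Let bg : bounded_measurable g. Proof. by split => //; exists M. Qed.

Let E i (h : T -> R) := \int[P]_w h (Y i w).

Let PT : P setT = 1%E. Proof. exact: probability_setT. Qed.

Let Pfin : (P setT < +oo)%E. Proof. by rewrite PT ltry. Qed.

Let pE i : positive_functional (E i).
Proof. exact: positive_functional_expectation. Qed.

Let E_cst i (c : R) : E i (fun=> c) = c.
Proof. by rewrite /E Rintegral_cst// (congr1 fine PT : fine _ = 1) mulr1. Qed.

(** The chord bound is affine in g, so its expectation depends only on the mean m; it is the moment
    generating function of a variable on {-M, M} with mean m. Then [chernoff_bernoulli] applies with
    p = (M + m) / (2M) and u = sM. *)
Lemma hoeffding_mgf (s : R) i :
  \int[P]_w expR (s * g (Y i w)) <=
  expR (s * \int[P]_w g (Y i w) + (s * M) ^+ 2 / 2).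
Proof.
set m := \int[P]_w g (Y i w).
have mM : - M <= m <= M.
  have bc c : @bounded_measurable R dT T (fun=> c) := bounded_measurable_cst c.
  rewrite -[in - M <= _](E_cst i (- M)) -[in _ <= M](E_cst i M).
  by apply/andP; split; apply: (pfun_le (pE i)) => // x; have := gM x;
    rewrite ler_norml => /andP[].
set a := expR (s * M); set b := expR (- (s * M)).
have -> : s * m = (2 * ((M + m) / (2 * M)) - 1) * (s * M) by field; rewrite gt_eqF.
apply: le_trans (chernoff_bernoulli _ _); last first.
  by apply/andP; split; [apply: divr_ge0|rewrite ler_pdivrMr ?mulr_gt0//]; lra.
rewrite -/a -/b.
have -> : (M + m) / (2 * M) * a + (1 - (M + m) / (2 * M)) * b =
    E i (fun x => (a - b) / (2 * M) * g x + (a + b) / 2).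
  have bag := bounded_measurableZ ((a - b) / (2 * M)) bg.
  rewrite (pfunD (pE i))//; last exact: bounded_measurable_cst.
  by rewrite (pfunZ (pE i))// E_cst /E -/m; field; rewrite gt_eqF.
apply: (pfun_le (pE i) (g := fun x => expR (s * g x))).
- by apply: bounded_measurable_expR; exact: bounded_measurableZ.
- apply: bounded_measurableD; first exact: bounded_measurableZ.
  exact: bounded_measurable_cst.
- move=> x; apply: le_trans (expR_chord s M0 (gM x)) _.
  by rewrite -/a -/b le_eqVlt; apply/orP; left; apply/eqP; field; rewrite gt_eqF.
Qed.

Lemma hoeffding_upper (t : R) : 0 <= t ->
  (P [set w | (N%:R * t < \sum_(i < N) (g (Y i w) - \int[P]_w g (Y i w)))%R]
    <= (expR (- (N%:R * t ^+ 2 / (2 * M ^+ 2))))%:E)%E.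
Proof.
(* This s minimizes the exponent s^2 M^2 / 2 - s t contributed by each variable, with minimum - t^2
   / (2 M^2). *)
move=> t0; set A := [set w | _]; pose s := t / M ^+ 2.
pose m i := \int[P]_w g (Y i w).
have bS : bounded_measurable (fun w => \sum_(i < N) (g (Y i w) - m i)).
  apply: bounded_measurable_sum => i; apply: bounded_measurableB.
    exact: bounded_measurable_comp bg.
  exact: bounded_measurable_cst.
have mA : measurable A.
  have -> : A = setT `&` (fun w => \sum_(i < N) (g (Y i w) - m i)) @^-1` `]N%:R * t, +oo[.
    by rewrite setTI; apply/seteqP; split => x /=; rewrite in_itv/= andbT.
  by have [mS _] := bS; exact: mS.
pose G i (x : T) : R := expR (- (s * m i) - s * t) * expR (s * g x).
have bG i : bounded_measurable (G i).
  apply: bounded_measurableZ; apply: bounded_measurable_expR.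
  exact: bounded_measurableZ.
(* Markov's inequality: the product is the exponential of s times the excess of the sum over N t,
   hence at least 1 on [A] and positive elsewhere. *)
have PA : fine (P A) <= \int[P]_w (\prod_(i < N) G i (Y i w)).
  rewrite -[in leLHS](setIT A) -Rintegral_indic//.
  apply: le_Rintegral => //.
  - by apply: bounded_measurable_integrable => //; exact: bounded_measurable_indic.
  - apply: bounded_measurable_integrable => //.
    by apply: bounded_measurable_prod => i; exact: bounded_measurable_comp (bG i).
  - move=> w _; under eq_bigr do rewrite /G -expRD.
    rewrite -expR_sum indicE; have [Aw|Aw] := pselect (A w); last first.
      by rewrite memNset// expR_ge0.
    rewrite mem_set//= -[leLHS]expR0 ler_expR.
    have -> : \sum_(i < N) (- (s * m i) - s * t + s * g (Y i w)) =
        s * (\sum_(i < N) (g (Y i w) - m i) - N%:R * t).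
      have -> : N%:R * t = \sum_(i < N) t by rewrite sumr_const card_ord mulr_natl.
      by rewrite -sumrB mulr_sumr; apply: eq_bigr => i _; ring.
    by rewrite mulr_ge0 ?divr_ge0 ?sqr_ge0 ?subr_ge0//; exact: ltW.
rewrite -[P A]fineK ?fin_num_measure// lee_fin (le_trans PA)//.
rewrite (expectation_prod mY indepY)//; last by move=> i x; rewrite mulr_ge0 ?expR_ge0.
apply: (@le_trans _ _ (\prod_(i < N) expR (- (t ^+ 2 / (2 * M ^+ 2))))).
  apply: ler_prod => i _; rewrite Rintegral_ge0 => [|x _]; last by rewrite mulr_ge0 ?expR_ge0.
  have -> : \int[P]_w G i (Y i w) =
      expR (- (s * m i) - s * t) * \int[P]_w expR (s * g (Y i w)).
    rewrite -[LHS]/(E i (G i)) (pfunZ (pE i))//.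
    by apply: bounded_measurable_expR; exact: bounded_measurableZ.
  apply: (@le_trans _ _ (expR (- (s * m i) - s * t) * expR (s * m i + (s * M) ^+ 2 / 2))).
    by rewrite ler_wpM2l ?expR_ge0// hoeffding_mgf.
  by rewrite -expRD ler_expR le_eqVlt /s; apply/orP; left; apply/eqP; field; rewrite gt_eqF.
rewrite -expR_sum ler_expR sumr_const card_ord.
by rewrite -[_ *+ N]mulr_natl mulrN mulrA.
Qed.

End hoeffding_upper.

Section hoeffding.
Context {R : realType} {dO dT : measure_display}.
Context {Omega : measurableType dO} {T : measurableType dT} {N : nat}.
Variables (P : probability Omega R) (Y : 'I_N -> Omega -> T).
Hypothesis mY : forall i, measurable_fun setT (Y i).
Hypothesis indepY : mutually_independent P Y.
Variables (g : T -> R) (M : R).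
Hypotheses (mg : measurable_fun setT g) (M0 : 0 < M) (gM : forall x, `|g x| <= M).

(** Union bound over the two tails, given by [hoeffding_upper] for g and for -g. *)
Lemma hoeffding (t : R) : 0 <= t ->
  ((1 - 2 * expR (- (N%:R * t ^+ 2 / (2 * M ^+ 2))))%:E <=
  P [set w | (`|\sum_(i < N) (g (Y i w) - \int[P]_w g (Y i w))| <= N%:R * t)%R])%E.
Proof.
move=> t0; pose S w := \sum_(i < N) (g (Y i w) - \int[P]_w g (Y i w)).
set A := [set w | _].
have bg : bounded_measurable g by split => //; exists M.
have Pfin : (P setT < +oo)%E by rewrite probability_setT ltry.
have mS : measurable_fun setT S.
  suff [] : bounded_measurable S by [].
  apply: bounded_measurable_sum => i; apply: bounded_measurableB.
    exact: bounded_measurable_comp bg.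
  exact: bounded_measurable_cst.
have mA : measurable A.
  have -> : A = setT `&` S @^-1` `[- (N%:R * t), N%:R * t].
    by rewrite setTI; apply/seteqP; split => x /=; rewrite in_itv/= -ler_norml.
  exact: mS.
pose A1 := [set w | N%:R * t < S w]; pose A2 := [set w | N%:R * t < - S w].
have mA1 : measurable A1.
  have -> : A1 = setT `&` S @^-1` `]N%:R * t, +oo[.
    by rewrite setTI; apply/seteqP; split => x /=; rewrite in_itv/= andbT.
  exact: mS.
have mA2 : measurable A2.
  have -> : A2 = setT `&` S @^-1` `]-oo, - (N%:R * t)[.
    by rewrite setTI; apply/seteqP; split => x /=; rewrite in_itv/= ltrNr.
  exact: mS.
have PA1 := hoeffding_upper mY indepY mg M0 gM t0.
have gM' x : `|- g x| <= M by rewrite normrN.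
have PA2 := hoeffding_upper mY indepY (measurable_funN mg) M0 gM' t0.
have EN i : \int[P]_w - g (Y i w) = - \int[P]_w g (Y i w).
  rewrite -[RHS]mulN1r -RintegralZl//.
    by apply: eq_Rintegral => z _; rewrite mulN1r.
  by apply: bounded_measurable_integrable => //; exact: bounded_measurable_comp bg.
have SE w : \sum_(i < N) (- g (Y i w) - \int[P]_w - g (Y i w)) = - S w.
  by rewrite /S -sumrN; apply: eq_bigr => i _; rewrite EN opprB opprK addrC.
have A2E : [set w | N%:R * t < \sum_(i < N) (- g (Y i w) - \int[P]_w - g (Y i w))] = A2.
  by apply/seteqP; split => w; rewrite /A2 /= SE.
rewrite A2E in PA2.
have PC : (P (~` A) <= (2 * expR (- (N%:R * t ^+ 2 / (2 * M ^+ 2))))%:E)%E.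
  have CA : ~` A `<=` A1 `|` A2.
    move=> w /negP; rewrite -ltNge -/(S w) => NtS.
    by have [S0|S0] := leP 0 (S w); [left|right]; rewrite /A1 /A2 /=;
      move: NtS; rewrite ?(ger0_norm S0)// ltr0_norm.
  apply: (le_trans (le_measure _ _ _ CA)); rewrite ?inE; [exact: measurableC|exact: measurableU|].
  apply: (le_trans (measureU2 _ _ _)) => //.
  by rewrite mulr2n mulrDl mul1r EFinD leeD.
have PAE : P A = (1 - P (~` A))%E by rewrite -probability_setC ?setCK//; exact: measurableC.
rewrite PAE EFinB leeB//.
Qed.

End hoeffding.

(** * Thermodynamic integration *)

Section thermodynamic_integration.
Context {R : realType} {dT : measure_display} {T : measurableType dT}.
Variables (mu : {measure set T -> \bar R}) (D : set T) (f : T -> R).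
Hypotheses (mD : measurable D) (muD : mu D = 1%E) (bf : bounded_measurable f).

Let Dfin : (mu D < +oo)%E. Proof. by rewrite muD ltry. Qed.

Lemma bounded_measurable_tilt (b : R) :
  bounded_measurable (fun x => expR (b * f x)).
Proof. by apply: bounded_measurable_expR; exact: bounded_measurableZ. Qed.

(** Differentiation under the integral sign, with a constant dominating the derivative in c over ]b
    - 1, b + 1[. *)
Lemma is_derive_tilt (g : T -> R) (b : R) : bounded_measurable g ->
  is_derive b 1 (fun c => \int[mu]_(x in D) (g x * expR (c * f x)))
    (\int[mu]_(x in D) (g x * f x * expR (b * f x))).
Proof.
have near_norm (u v w : R) : u - 1 < v -> v < u + 1 -> - u <= w -> u <= w ->
    - (w + 1) <= v <= w + 1 by lra.
move=> bg; pose F (c : R) (x : T) := g x * expR (c * f x).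
have dF (c : R) x : is_derive c 1 (F ^~ x) (g x * f x * expR (c * f x)).
  by rewrite /F; apply: is_derive_eq; rewrite /GRing.scale/=; ring.
have d1F (c : R) x : (partial1of2 F) c x = g x * f x * expR (c * f x).
  by rewrite partial1of2E; have [] := dF c x.
have [M M0 fM] : exists2 M, 0 <= M & forall x, `|f x| <= M.
  by have [_ [M fM]] := bf; exists M => //; exact: le_trans (normr_ge0 _) (fM point).
have [K K0 gK] : exists2 K, 0 <= K & forall x, `|g x| <= K.
  by have [_ [K gK]] := bg; exists K => //; exact: le_trans (normr_ge0 _) (gK point).
(* Within distance 1 of b one has |c| <= |b| + 1, so this bounds |g f exp(c f)| there. *)
pose C : R := K * M * expR ((`|b| + 1) * M).
have Ib : `]b - 1, b + 1[%classic b by rewrite /= in_itv/=; lra.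
have intF (c : R) : `]b - 1, b + 1[%classic c -> mu.-integrable D (EFin \o F c).
  move=> _; apply: bounded_measurable_integrable => //.
  by apply: bounded_measurableM => //; exact: bounded_measurable_tilt.
have derF (c : R) x : `]b - 1, b + 1[%classic c -> D x -> derivable (F ^~ x) c 1.
  by move=> _ _; have [] := dF c x.
have C0 : forall x : T, 0 <= C by move=> _; rewrite !mulr_ge0 ?expR_ge0.
have intC : mu.-integrable D (EFin \o (fun=> C)).
  by apply: bounded_measurable_integrable => //; exact: bounded_measurable_cst.
have Fub (c : R) x : `]b - 1, b + 1[%classic c -> D x -> `|(partial1of2 F) c x| <= C.
  rewrite /= in_itv/= => /andP[bc cb] _; rewrite d1F 2!normrM.
  rewrite !ler_pM ?mulr_ge0// ger0_norm ?expR_ge0// ler_expR.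
  rewrite (le_trans (ler_norm _))// normrM ler_pM//.
  by rewrite ler_norml (near_norm b)// ?ler_norm// -normrN ler_norm.
have dI := derivable_under_integral mD Ib intF derF C0 intC Fub.
have eI := differentiation_under_integral mD Ib intF derF C0 intC Fub.
split; first exact: dI.
by rewrite -derive1E eI; apply: eq_Rintegral => x _; rewrite d1F.
Qed.

Lemma continuous_tilt (g : T -> R) : bounded_measurable g ->
  continuous (fun c : R => \int[mu]_(x in D) (g x * expR (c * f x))).
Proof.
move=> bg b; apply: differentiable_continuous; apply/derivable1_diffP.
by have [] := is_derive_tilt b bg.
Qed.

Let Z (b : R) := \int[mu]_(x in D) expR (b * f x).

(** The integrand is at least the positive constant exp(- |b| M), and D has mass 1. *)
Lemma partition_gt0 (b : R) : 0 < \int[mu]_(x in D) expR (b * f x).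
Proof.
have [_ [M fM]] := bf.
apply: (@lt_le_trans _ _ (\int[mu]_(x in D) expR (- (`|b| * M)))).
  by rewrite Rintegral_cst// muD mulr1 expR_gt0.
apply: le_Rintegral => //.
- by apply: bounded_measurable_integrable => //; exact: bounded_measurable_cst.
- by apply: bounded_measurable_integrable => //; exact: bounded_measurable_tilt.
- move=> x _; rewrite ler_expR lerNl (le_trans (ler_norm _))// normrN normrM.
  by rewrite ler_wpM2l.
Qed.

Let ZE : Z = (fun b => \int[mu]_(x in D) (1 * expR (b * f x))).
Proof. by apply/funext => b; apply: eq_Rintegral => x _; rewrite mul1r. Qed.

Let dlnZ (b : R) : is_derive b 1 (fun c => ln (Z c))
  ((\int[mu]_(x in D) (f x * expR (b * f x))) / Z b).
Proof.
have dZ : is_derive b 1 Z (\int[mu]_(x in D) (f x * expR (b * f x))).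
  rewrite ZE; have := is_derive_tilt b (bounded_measurable_cst 1).
  by under [X in is_derive _ _ _ X]eq_Rintegral do rewrite mul1r.
have dl := is_derive1_ln (partition_gt0 b).
have := @is_derive1_comp _ (@ln R) Z b _ _ dl dZ.
by rewrite mulrC.
Qed.

Lemma continuous_tilted_mean : continuous (fun b : R =>
  (\int[mu]_(x in D) (f x * expR (b * f x))) / \int[mu]_(x in D) expR (b * f x)).
Proof.
move=> b; apply: cvgM; first exact: continuous_tilt.
apply: cvgV; first by rewrite gt_eqF// partition_gt0.
have := @continuous_tilt _ (bounded_measurable_cst 1) b.
by rewrite -ZE.
Qed.

(** Fundamental theorem of calculus for b |-> ln (Z b), whose value at b = 0 is the logarithm of the
    mass of D, that is 0. *)
Lemma log_partition_integral :
  (\int[lebesgue_measure]_(b in `[0%R, 1%R])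
    ((\int[mu]_(x in D) (f x * expR (b * f x))) /
     \int[mu]_(x in D) expR (b * f x))%R%:E)%E =
  (ln (\int[mu]_(x in D) expR (f x)))%:E.
Proof.
have clnZ (b : R) : {for b, continuous (fun c : R => ln (Z c))}.
  apply: differentiable_continuous; apply/derivable1_diffP.
  by have [] := dlnZ b.
rewrite (@continuous_FTC2 _ _ (fun c => ln (Z c)))//.
- rewrite -EFinB /Z; congr (_%:E).
  under [X in ln X - _]eq_Rintegral do rewrite mul1r.
  under [X in _ - ln X]eq_Rintegral do rewrite mul0r expR0.
  by rewrite Rintegral_cst// muD mulr1 ln1 subr0.
- exact/continuous_subspaceT/continuous_tilted_mean.
- split => [b _||]; first by have [] := dlnZ b.
  + exact/cvg_at_right_filter/clnZ.
  + exact/cvg_at_left_filter/clnZ.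
- by move=> b _; rewrite derive1E; have [] := dlnZ b.
Qed.

End thermodynamic_integration.

(** * Mixtures, Gibbs measures, total variation and couplings *)

Section mixture.
Context {R : realType} {dT : measure_display} {T : measurableType dT}.
Variable k : R -> probability T R.
Hypothesis mk : forall B, measurable B -> measurable_fun unit_itv (k ^~ B).

Let I01 : @measurable _ (measurableTypeR R) unit_itv. Proof. exact: measurable_itv. Qed.

Let I01fin : (lebesgue_measure (@unit_itv R) < +oo)%E.
Proof. by rewrite /unit_itv lebesgue_measure_itv/= lte01 -EFinD ltry. Qed.

(* The kernel is only measurable on [0,1]: freeze it outside. *)
Let k' (b : R) : probability T R := if b \in unit_itv then k b else k 0.

Let mk' B : measurable B ->
  @measurable_fun _ _ (measurableTypeR R) _ setT (k' ^~ B).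
Proof.
move=> mB; have -> : k' ^~ B = fun b => if b \in unit_itv then k b B else k 0 B.
  by apply/funext => b; rewrite /k'; case: ifP.
apply: measurable_fun_if => //.
- apply: (measurable_fun_bool true); rewrite setTI.
  rewrite (_ : _ @^-1` _ = unit_itv)//.
  by apply/seteqP; split => b /= => [/set_mem|/mem_set].
- rewrite setTI (_ : _ @^-1` _ = unit_itv); first exact: mk.
  by apply/seteqP; split => b /= => [/set_mem|/mem_set].
Qed.

Let bk' g : bounded_measurable g ->
  @bounded_measurable R _ (measurableTypeR R) (fun b => \int[k' b]_x g x).
Proof.
move=> bg; have [mg [M gM]] := bg.
have kfin b : (k' b setT < +oo)%E by rewrite probability_setT ltry.
have pE b := positive_functional_expectation (kfin b) (@measurable_id _ T setT).
have cE b (c : R) : \int[k' b]_x c = c.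
  have k1 : k' b setT = 1%E by exact: probability_setT.
  by rewrite Rintegral_cst// (congr1 fine k1 : fine _ = 1) mulr1.
have bM : bounded_measurable (fun=> M : R) := bounded_measurable_cst (T := T) M.
split.
  (* Measurability of integrals against a kernel is applied to the nonnegative function g + M; each
     [k' b] has mass 1, so M is subtracted back. *)
  have -> : (fun b => \int[k' b]_x g x) = (fun b => \int[k' b]_x (g x + M) - M).
    apply/funext => b; apply/eqP; rewrite eq_sym subr_eq -[in X in _ == _ + X](cE b M).
    exact/eqP/(pfunD (pE b)).
  apply: measurable_funB => //.
  apply: measurableT_comp => //.
  apply: (@measurable_fun_integral_kernel _ _ (measurableTypeR R) _ _ k' mk' (fun x => (g x + M)%:E)).
    by move=> x; rewrite lee_fin; have := gM x; rewrite ler_norml; lra.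
  by apply/measurable_EFinP; exact: measurable_funD.
exists M => b; rewrite ler_norml; apply/andP; split.
  rewrite -(cE b (- M)); apply: (pfun_le (pE b)) => //; first exact: bounded_measurable_cst.
  by move=> x; have := gM x; rewrite ler_norml => /andP[].
rewrite -[leRHS](cE b M); apply: (pfun_le (pE b)) => // x.
by have := gM x; rewrite ler_norml => /andP[].
Qed.

Lemma integrable_kernel_mean g : bounded_measurable g ->
  lebesgue_measure.-integrable unit_itv (EFin \o (fun b => \int[k b]_x g x)).
Proof.
move=> bg; refine (eq_integrable I01 (EFin \o (fun b => \int[k' b]_x g x)) _ _ _).
  by move=> b b01; rewrite /= /k' b01.
by apply: bounded_measurable_integrable => //; exact: bk'.
Qed.

Lemma expectation_mixture {dO : measure_display} {Omega : measurableType dO}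
    (P : probability Omega R) (X : Omega -> T) (g : T -> R) :
  measurable_fun setT X ->
  (forall B, measurable B ->
    P (X @^-1` B) = (\int[lebesgue_measure]_(b in unit_itv) k b B)%E) ->
  bounded_measurable g ->
  \int[P]_w g (X w) =
    \int[lebesgue_measure]_(b in unit_itv) \int[k b]_x g x.
Proof.
move=> mX lawX bg.
have Pfin : (P setT < +oo)%E by rewrite probability_setT ltry.
apply: (@pfun_eq R dT T (fun h => \int[P]_w h (X w))
  (fun h => \int[lebesgue_measure]_(b in unit_itv) \int[k b]_x h x)) => //.
- exact: positive_functional_expectation.
- have kfin b : (k b setT < +oo)%E by rewrite probability_setT ltry.
  have pE b := positive_functional_expectation (kfin b) (@measurable_id _ T setT).
  split=> [h1 h2 bh1 bh2|c h bh|h bh h0].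
  + rewrite -RintegralD//; [|exact: integrable_kernel_mean..].
    by apply: eq_Rintegral => b _; exact: (pfunD (pE b)).
  + rewrite -RintegralZl//; last exact: integrable_kernel_mean.
    by apply: eq_Rintegral => b _; exact: (pfunZ (pE b)).
  + by apply: Rintegral_ge0 => b _; exact: (pfun_ge0 (pE b)).
- move=> A mA.
  rewrite Rintegral_indic_comp//; apply: (etrans (congr1 fine (lawX _ mA))).
  congr fine; apply: eq_integral => b _.
  by rewrite Rintegral_indic// setIT fineK// fin_num_measure.
Qed.

End mixture.

(** * The unit cube and the Euclidean distance *)

Section cube.
Context {R : realType} {d : nat}.

Lemma measurable_cube : measurable (@cube R d).
Proof.
have -> : @cube R d = \bigcap_(i in [set: 'I_d]) ((fun x => tnth x i) @^-1` `[0, 1]).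
  apply/seteqP; split => x /= H i; first by move=> _; rewrite /= in_itv/= H.
  by have := H i I; rewrite /= in_itv.
apply: fin_bigcap_measurable => [|i _]; first exact: finite_finset.
have := @measurable_tnth _ R d i measurableT `[0, 1]%classic (measurable_itv _).
by rewrite setTI.
Qed.

Lemma cube_neq0 : @cube R d !=set0.
Proof.
by exists [tuple 0 | i < d] => i; rewrite tnth_mktuple lexx ler01.
Qed.

Lemma lebesgue_cube (mu : {measure set (d.-tuple R) -> \bar R}) :
  is_lebesgue_Rd mu -> mu cube = 1%E.
Proof.
move=> /(_ (fun=> 0) (fun=> 1)) H; have -> : cube = box (fun=> 0) (fun=> 1) by [].
by rewrite H// big1 => [//|i _]; rewrite subr0.
Qed.

Lemma eucl_ge0 (x y : d.-tuple R) : 0 <= eucl x y.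
Proof. exact: sqrtr_ge0. Qed.

Lemma measurable_eucl :
  measurable_fun setT (fun z : d.-tuple R * d.-tuple R => eucl z.1 z.2).
Proof.
apply: measurableT_comp; first by apply: continuous_measurable_fun; exact: sqrt_continuous.
apply: measurable_sum => i; apply: measurable_funX; apply: measurable_funB.
  by apply: (measurableT_comp (measurable_tnth i)).
by apply: (measurableT_comp (measurable_tnth i)).
Qed.

End cube.

(** * Gibbs means and their distance to means under another distribution *)

Section gibbs.
Context {R : realType} {d : nat}.
Variables (mu : {measure set (d.-tuple R) -> \bar R}) (f : d.-tuple R -> R).
Hypotheses (mucube : mu cube = 1%E) (bf : bounded_measurable f).
Hypothesis f_out : forall x, ~ cube x -> f x = 0.

Let mcube := @measurable_cube R d.

Let cubefin : (mu cube < +oo)%E. Proof. by rewrite mucube ltry. Qed.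

(** [gibbs] is a bare set function, so means under it are taken through its density against mu;
    [gibbs_mean_indic] ties the two together. *)
Definition gibbs_mean (b : R) (g : d.-tuple R -> R) : R :=
  \int[mu]_(x in cube) (g x * (expR (b * f x) / Zpart mu (fun y => b * f y))).

Let Z (b : R) := Zpart mu (fun x => (b * f x)%R).

Let Z_gt0 b : 0 < Z b. Proof. exact: partition_gt0. Qed.

Let bw b : bounded_measurable (fun x => expR (b * f x) / Z b).
Proof.
apply: bounded_measurableM; first exact: bounded_measurable_tilt.
exact: bounded_measurable_cst.
Qed.

Lemma positive_functional_gibbs_mean b : positive_functional (gibbs_mean b).
Proof.
apply: positive_functional_Rintegral => //.
by move=> x; rewrite divr_ge0 ?expR_ge0// ltW// Z_gt0.
Qed.

Lemma gibbs_meanE b g : bounded_measurable g ->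
  gibbs_mean b g = \int[mu]_(x in cube) (g x * expR (b * f x)) / Z b.
Proof.
move=> bg; rewrite /gibbs_mean; under eq_Rintegral do rewrite mulrA.
rewrite RintegralZr//; apply: bounded_measurable_integrable => //.
by apply: bounded_measurableM => //; exact: bounded_measurable_tilt.
Qed.

Lemma gibbs_mean_indic b A : measurable A ->
  (gibbs_mean b \1_A)%:E = gibbs mu (fun x => (b * f x)%R) A.
Proof.
move=> mA; rewrite gibbs_meanE; last exact: bounded_measurable_indic.
rewrite /gibbs EFinM; congr (_ * _)%E.
have -> : \int[mu]_(x in cube) (\1_A x * expR (b * f x)) =
    \int[mu]_(x in A `&` cube) expR (b * f x).
  rewrite setIC Rintegral_mkcondr; apply: eq_Rintegral => x _.
  by rewrite patchE indicE; case: ifP; rewrite ?mul1r ?mul0r.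
rewrite fineK//; apply: integrable_fin_num; first exact: measurableI.
apply: bounded_measurable_integrable; [exact: measurableI| |exact: bounded_measurable_tilt].
by apply: le_lt_trans cubefin; apply: le_measure; rewrite ?inE//; exact: measurableI.
Qed.

Lemma gibbs_mean1 b : gibbs_mean b (fun=> 1) = 1.
Proof.
rewrite gibbs_meanE; last exact: bounded_measurable_cst.
under eq_Rintegral do rewrite mul1r.
by rewrite divff// gt_eqF// Z_gt0.
Qed.

Lemma gibbs_mean_cube b : gibbs_mean b \1_cube = 1.
Proof.
rewrite -[RHS](gibbs_mean1 b); apply: eq_Rintegral => x xc.
by rewrite indicE xc.
Qed.

Lemma log_partition_gibbs_mean :
  Lpart mu f = \int[lebesgue_measure]_(b in unit_itv) gibbs_mean b f /\
  lebesgue_measure.-integrable unit_itv (EFin \o (fun b => gibbs_mean b f)).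
Proof.
have E : (fun b => gibbs_mean b f) = (fun b => \int[mu]_(x in cube) (f x * expR (b * f x)) /
    \int[mu]_(x in cube) expR (b * f x)).
  by apply/funext => b; rewrite gibbs_meanE.
split.
  apply: (etrans (esym (congr1 fine (log_partition_integral mcube mucube bf)))).
  by apply: eq_Rintegral => b _; rewrite gibbs_meanE.
rewrite E; apply: continuous_compact_integrable; first exact: segment_compact.
exact/continuous_subspaceT/continuous_tilted_mean.
Qed.

Section target.
Variables (b : R) (Q : probability (d.-tuple R) R).
Hypothesis Qcube : Q cube = 1%E.

Let Qfin : (Q setT < +oo)%E. Proof. by rewrite probability_setT ltry. Qed.

Let pQ : positive_functional (fun g => \int[Q]_x g x).
Proof. exact: (positive_functional_expectation Qfin (@measurable_id _ _ setT)). Qed.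

Let QE A : measurable A -> (\int[Q]_x \1_A x)%:E = Q A.
Proof. by move=> mA; rewrite Rintegral_indic// setIT fineK// fin_num_measure. Qed.

Lemma gibbs_mean_dTV (M : R) : (forall x, `|f x| <= M) ->
  ((`|gibbs_mean b f - \int[Q]_x f x|)%R%:E <=
    (2 * M)%R%:E * dTV (gibbs mu (fun x => (b * f x)%R)) Q)%E.
Proof.
move=> fM; set t := dTV _ _.
have pG := positive_functional_gibbs_mean b.
have GQ A : measurable A ->
    (`|gibbs mu (fun x => (b * f x)%R) A - Q A| =
     (`|gibbs_mean b \1_A - \int[Q]_x \1_A x|)%R%:E)%E.
  by move=> mA; rewrite -gibbs_mean_indic// -QE.
have le01 K A : positive_functional K -> K (fun=> 1) = 1 -> measurable A ->
    0 <= K (\1_A : d.-tuple R -> R) <= 1.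
  move=> pK K1 mA; have bA := bounded_measurable_indic mA.
  rewrite (pfun_ge0 pK)//= -[leRHS]K1 (pfun_le pK)//.
  exact: bounded_measurable_cst.
have Q1 : \int[Q]_x 1 = 1.
  have Q1 : Q setT = 1%E by exact: probability_setT.
  by rewrite Rintegral_cst// (congr1 fine Q1 : fine _ = 1) mulr1.
(* Both distributions give events a mass in [0, 1], so t is a real number and can serve as eps in
   [pfun_close_norm]. *)
have t1 : (t <= 1)%E.
  apply: ge_ereal_sup => _ [A /= mA <-]; rewrite GQ// lee_fin ler_norml.
  have := le01 _ _ pG (gibbs_mean1 b) mA; have := le01 _ _ pQ Q1 mA; lra.
have tub A : measurable A -> ((`|gibbs_mean b \1_A - \int[Q]_x \1_A x|)%R%:E <= t)%E.
  by move=> mA; rewrite -GQ//; apply: ereal_sup_ubound; exists A.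
have t0 : (0 <= t)%E.
  by apply: le_trans (tub _ measurableT); rewrite lee_fin.
have tfin : t \is a fin_num by rewrite ge0_fin_numE// (le_lt_trans t1)// ltry.
rewrite -(fineK tfin) -EFinM lee_fin.
apply: (pfun_close_norm pG pQ) => //; first by rewrite gibbs_mean1 Q1.
  by move=> A mA; rewrite -lee_fin fineK// tub.
by have [] := bf.
Qed.

(** By the marginals, the difference of the means is the integral of f z.1 - f z.2 against pi. The
    Lipschitz bound holds for pairs in the cube, hence pi-almost everywhere. *)
Lemma gibbs_mean_coupling (L : R) (pi : probability (d.-tuple R * d.-tuple R)%type R) :
  0 <= L -> (forall x y, cube x -> cube y -> `|f x - f y| <= L * eucl x y) ->
  coupling (gibbs mu (fun x => (b * f x)%R)) Q pi ->
  ((`|gibbs_mean b f - \int[Q]_x f x|)%R%:E <= L%:E * \int[pi]_z (eucl z.1 z.2)%:E)%E.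
Proof.
move=> L0 fL cpl.
have pifin : (pi setT < +oo)%E by rewrite probability_setT ltry.
have pG := positive_functional_gibbs_mean b.
have p1 := positive_functional_expectation pifin (@measurable_fst _ _ _ _).
have p2 := positive_functional_expectation pifin (@measurable_snd _ _ _ _).
have b1 : bounded_measurable (fun z : d.-tuple R * d.-tuple R => f z.1).
  exact: bounded_measurable_comp bf.
have b2 : bounded_measurable (fun z : d.-tuple R * d.-tuple R => f z.2).
  exact: bounded_measurable_comp bf.
have E1 : gibbs_mean b f = \int[pi]_z f z.1.
  apply: (pfun_eq pG p1) => // A mA; apply: EFin_inj.
  rewrite gibbs_mean_indic//; have [<- _] := cpl A mA.
  rewrite Rintegral_indic_comp// fineK ?fin_num_measure//.
    by congr (pi _); apply/seteqP; split => z /= => [[]|].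
  by rewrite -[X in measurable X]setTI; exact: measurable_fst.
have E2 : \int[Q]_x f x = \int[pi]_z f z.2.
  apply: (pfun_eq pQ p2) => // A mA; apply: EFin_inj.
  rewrite QE//; have [_ <-] := cpl A mA.
  rewrite Rintegral_indic_comp// fineK ?fin_num_measure//.
    by congr (pi _); apply/seteqP; split => z /= => [[]|].
  by rewrite -[X in measurable X]setTI; exact: measurable_snd.
rewrite E1 E2 -RintegralB//; [|exact: bounded_measurable_integrable..].
have b12 := bounded_measurableB b1 b2.
rewrite EFin_normr_Rintegral//; last exact: bounded_measurable_integrable.
have [m12 _] := b12.
apply: (le_trans (le_abse_integral _ _ _)) => //; first exact/measurable_EFinP.
have me := @measurable_eucl R d.
rewrite -ge0_integralZl//; [|exact/measurable_EFinP|by move=> z _; rewrite lee_fin eucl_ge0].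
apply: ae_ge0_le_integral => //.
- by apply: measurableT_comp => //; exact/measurable_EFinP.
- by move=> z _; rewrite mule_ge0 ?lee_fin ?eucl_ge0.
- by apply: measurable_funeM; exact/measurable_EFinP.
(* The pairs with a component off the cube; both marginals give no mass to the complement of the
   cube. *)
- exists ((~` cube `*` setT) `|` (setT `*` ~` cube)); split.
  + by apply: measurableU; apply: measurableX => //; exact: measurableC.
  + have mC := measurableC mcube.
    have [pi1 pi2] := cpl _ mC.
    apply/eqP; rewrite -measure_le0 (le_trans (measureU2 _ _ _))//; [exact: measurableX..|].
    have Q0 : Q (~` cube) = 0%E by rewrite probability_setC// Qcube subee.
    have G0 : gibbs mu (fun x => (b * f x)%R) (~` cube) = 0%E.
      by rewrite /gibbs setICl integral_set0 mul0e.
    by rewrite [X in (X + _)%E]pi1 [X in (_ + X)%E]pi2 Q0 G0 adde0.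
  + move=> z /= H; apply: contrapT => /not_orP[z1 z2]; apply: H => _.
    rewrite lee_fin fL//; apply: contrapT => zc; [exact: z1|exact: z2].
Qed.

(** For L > 0, dividing by L lets the coupling bound pass to the infimum. For L = 0 the right-hand
    side is 0 even if [W1] is infinite, and the two means are equal because f is constant on the
    cube. *)
Lemma gibbs_mean_W1 (L : R) :
  0 <= L -> (forall x y, cube x -> cube y -> `|f x - f y| <= L * eucl x y) ->
  ((`|gibbs_mean b f - \int[Q]_x f x|)%R%:E <=
    L%:E * W1 (gibbs mu (fun x => (b * f x)%R)) Q)%E.
Proof.
move=> L0 fL; have [L_gt0|] := ltP 0 L.
  rewrite muleC -lee_pdivrMr//; apply: le_ereal_inf_tmp => _ [pi cpl <-].
  by rewrite lee_pdivrMr// muleC; exact: gibbs_mean_coupling.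
move=> L_le0; have {fL} fL x y : cube x -> cube y -> f x = f y.
  move=> xc yc; apply/eqP; rewrite -subr_eq0 -normr_le0.
  by rewrite (le_trans (fL _ _ xc yc))// mulr_le0_ge0 ?eucl_ge0.
have -> : L = 0 by apply/eqP; rewrite eq_le L0 L_le0.
have [x0 x0c] := @cube_neq0 R d.
(* As f vanishes off the cube, it is a multiple of the indicator of the cube, which has mean 1 on
   both sides. *)
have fE : f = (fun x => f x0 * \1_cube x).
  apply/funext => x; rewrite indicE; have [xc|xc] := pselect (cube x).
    by rewrite mem_set// mulr1; exact: fL.
  by rewrite memNset// mulr0 f_out.
have bc : bounded_measurable (\1_cube : d.-tuple R -> R) by exact: bounded_measurable_indic.
have I1 : gibbs_mean b f = f x0.
  rewrite [X in gibbs_mean b X = _]fE (pfunZ (positive_functional_gibbs_mean b))//.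
  by rewrite gibbs_mean_cube mulr1.
have I2 : \int[Q]_x f x = f x0.
  rewrite [X in Rintegral _ _ X]fE (pfunZ pQ)//.
  by rewrite Rintegral_indic// setIT (congr1 fine Qcube : fine _ = 1) mulr1.
by rewrite I1 I2 subrr normr0 mul0e.
Qed.

End target.
End gibbs.

(** Both terms are integrals of means over an interval of length 1, so a bound for every b carries
    over. [C] is an extended real because it will be built from a supremum of distances. *)
Lemma log_partition_gap (R : realType) (d : nat)
    (mu : {measure set (d.-tuple R) -> \bar R}) (f : d.-tuple R -> R)
    (k : R -> probability (d.-tuple R) R) (C : \bar R) :
  mu cube = 1%E -> bounded_measurable f ->
  (forall B, measurable B -> measurable_fun unit_itv (k ^~ B)) ->
  (forall b, unit_itv b ->
    ((`|gibbs_mean mu f b f - \int[k b]_x f x|)%R%:E <= C)%E) ->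
  ((`|Lpart mu f - \int[lebesgue_measure]_(b in unit_itv) \int[k b]_x f x|)%R%:E
    <= C)%E.
Proof.
move=> mucube bf mk gapC.
have mI : @measurable _ (measurableTypeR R) unit_itv by exact: measurable_itv.
have leb1 : lebesgue_measure (@unit_itv R) = 1%E.
  by rewrite /unit_itv lebesgue_measure_itv/= lte01 -EFinD subr0.
have lebfin : (lebesgue_measure (@unit_itv R) < +oo)%E by rewrite leb1 ltry.
have [-> intG] := log_partition_gibbs_mean mucube bf.
have intk := integrable_kernel_mean mk bf.
rewrite -RintegralB//.
(* The gap at b = 0 excludes C = -oo; the value +oo is trivial. *)
have C0 : (0 <= C)%E.
  have I0 : unit_itv (0 : R) by rewrite /unit_itv/= in_itv/= lexx ler01.
  by apply: le_trans (gapC 0 I0); rewrite lee_fin.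
case: C C0 gapC => [c c0 gapC|_ _|//]; last by rewrite leey.
have intB := integrableB mI intG intk.
rewrite lee_fin (le_trans (le_normr_Rintegral _ _))//.
apply: (@le_trans _ _ (\int[lebesgue_measure]_(b in @unit_itv R) c)).
  apply: le_Rintegral => //.
  - exact: integrable_norm.
  - apply: bounded_measurable_integrable => //.
    exact: bounded_measurable_cst.
by rewrite Rintegral_cst// (congr1 fine leb1 : fine _ = 1) mulr1.
Qed.

(** * Replacing f by its restriction to the cube *)

Section restriction.
Context {R : realType} {d : nat}.
Variable f : d.-tuple R -> R.
Hypothesis bf : exists M : R, forall x, cube x -> `|f x| <= M.

Lemma cube_restrictE x : cube x -> (f \_ cube) x = f x.
Proof. by move=> xc; rewrite patchE mem_set. Qed.

Lemma cube_restrict_out x : ~ cube x -> (f \_ cube) x = 0.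
Proof. by move=> xc; rewrite patchE memNset. Qed.

Lemma supnorm_ge x : cube x -> `|f x| <= supnorm f.
Proof.
move=> xc; apply: ub_le_sup; last by exists x.
by have [M fM] := bf; exists M => _ [y yc <-]; exact: fM.
Qed.

Lemma supnorm_ge0 : 0 <= supnorm f.
Proof. by have [x xc] := @cube_neq0 R d; exact: le_trans (supnorm_ge xc). Qed.

(** Only on the cube is f bounded; extending it by 0 provides the global bound that positive
    functionals require. *)
Lemma cube_restrict_le_supnorm x : `|(f \_ cube) x| <= supnorm f.
Proof.
have [xc|xc] := pselect (cube x).
  by rewrite cube_restrictE// supnorm_ge.
by rewrite cube_restrict_out// normr0 supnorm_ge0.
Qed.

Lemma Lpart_restrict mu : Lpart mu f = Lpart mu (f \_ cube).
Proof.
congr ln; congr fine; apply: eq_integral => x /set_mem xc.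
by rewrite cube_restrictE.
Qed.

Lemma gibbs_restrict mu b :
  gibbs mu (fun x => b * f x) = gibbs mu (fun x => b * (f \_ cube) x).
Proof.
apply/funext => A; congr (_ * (_^-1)%:E)%E; [|congr fine].
  by apply: eq_integral => x /set_mem[_ xc]; rewrite cube_restrictE.
by apply: eq_integral => x /set_mem xc; rewrite cube_restrictE.
Qed.

(** The infimum is attained: at positive distance, divide by it; at distance 0, any admissible
    constant already forces f x = f y. *)
Lemma lipconstP : lipschitz_on_cube f -> 0 <= lipconst f /\
  forall x y, cube x -> cube y -> `|f x - f y| <= lipconst f * eucl x y.
Proof.
move=> [k fk]; rewrite /lipconst; set S := (X in inf X).
have S0 : S !=set0.
  (* The given k carries no sign, while the set defining [lipconst] asks for nonnegative
     constants. *)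
  exists `|k|; split=> // x y xc yc; rewrite (le_trans (fk _ _ xc yc))//.
  by rewrite ler_wpM2r ?eucl_ge0// ler_norm.
split; first by apply: lb_le_inf => // l [].
move=> x y xc yc; have [e0|e0] := ltP 0 (eucl x y).
  rewrite -ler_pdivrMr//; apply: lb_le_inf => // l [_ fl].
  by rewrite ler_pdivrMr// fl.
have e_eq0 : eucl x y = 0 by apply/eqP; rewrite eq_le e0 eucl_ge0.
by have [l [_ fl]] := S0; rewrite e_eq0 mulr0 -(mulr0 l) -e_eq0 fl.
Qed.

End restriction.

(** * Mean and concentration of the empirical average *)

Section estimator.
Context {R : realType} {dT dO : measure_display}.
Context {T : measurableType dT} {Omega : measurableType dO}.
Variables (P : probability Omega R) (N : nat) (Y : 'I_N -> Omega -> T).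
Hypotheses (HN : (0 < N)%N) (mY : forall i, measurable_fun setT (Y i)).
Hypothesis indepY : mutually_independent P Y.
Variables (g : T -> R) (M m : R).
Hypotheses (mg : measurable_fun setT g) (gM : forall x, `|g x| <= M).
Hypothesis Eg : forall i, \int[P]_w g (Y i w) = m.

Lemma expectation_mean : \int[P]_w (N%:R^-1 * \sum_(i < N) g (Y i w)) = m.
Proof.
have Pfin : (P setT < +oo)%E by rewrite probability_setT ltry.
have bgY i : bounded_measurable (fun w => g (Y i w)).
  by apply: bounded_measurable_comp => //; split=> //; exists M.
have pE := positive_functional_expectation Pfin (@measurable_id _ Omega setT).
rewrite (pfunZ pE); last exact: bounded_measurable_sum.
rewrite (pfun_sum pE)//; under eq_bigr do rewrite Eg.
by rewrite sumr_const card_ord -[m *+ N]mulr_natl mulKf// pnatr_eq0 -lt0n.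
Qed.

Lemma hoeffding_mean (delta : R) : 0 < delta ->
  ((1 - delta)%:E <= P [set w |
    (`|N%:R^-1 * \sum_(i < N) g (Y i w) - m| <=
      2 * M * Num.sqrt (ln (2 / delta) / (2 * N%:R)))%R])%E.
Proof.
move=> d0; set t := 2 * M * _.
have N0 : 0 < N%:R :> R by rewrite ltr0n.
have M0 : 0 <= M by exact: le_trans (normr_ge0 _) (gM point).
have t0 : 0 <= t by rewrite !mulr_ge0// sqrtr_ge0.
(* For delta >= 1 the claimed lower bound is at most 0; below 1 the logarithm of 2 / delta is
   positive. *)
have [d1|d1] := leP 1 delta.
  by apply: (@le_trans _ _ 0%E) => //; rewrite lee_fin subr_le0.
have dev w : \sum_(i < N) (g (Y i w) - \int[P]_w g (Y i w)) =
    N%:R * (N%:R^-1 * \sum_(i < N) g (Y i w) - m).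
  rewrite sumrB; under [X in _ - X]eq_bigr do rewrite Eg.
  by rewrite sumr_const card_ord mulrBr mulVKf ?gt_eqF// mulr_natl.
(* [hoeffding] needs M > 0; if M = 0 then g vanishes and there is no deviation. *)
have [M_gt0|M_le0] := ltP 0 M; last first.
  have g0 x : g x = 0 by apply/eqP; rewrite -normr_le0 (le_trans (gM x)).
  have m0 : m = 0.
    rewrite -(Eg (Ordinal HN)); under eq_Rintegral do rewrite g0.
    by rewrite Rintegral_cst// mul0r.
  rewrite [X in P X](_ : _ = setT); first by rewrite probability_setT lee_fin gerBl ltW.
  apply/seteqP; split=> // w _ /=; rewrite big1 => [|i _]; last exact: g0.
  by rewrite mulr0 m0 subr0 normr0.
have := hoeffding mY indepY mg M_gt0 gM t0.
(* The radius t solves N t^2 / (2 M^2) = ln (2 / delta). *)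
have -> : 2 * expR (- (N%:R * t ^+ 2 / (2 * M ^+ 2))) = delta.
  have l0 : 0 < ln (2 / delta) by rewrite ln_gt0// ltr_pdivlMr//; lra.
  have -> : - (N%:R * t ^+ 2 / (2 * M ^+ 2)) = ln (delta / 2).
    rewrite /t !exprMn sqr_sqrtr; last by rewrite divr_ge0 ?mulr_ge0 ?ltW.
    rewrite -[in RHS]invf_div lnV ?posrE ?divr_gt0//.
    by field; rewrite !gt_eqF.
  by rewrite lnK ?posrE ?divr_gt0// mulrC divfK.
congr (_ <= P _)%E; apply/seteqP; split=> w /=;
  by rewrite dev normrM ger0_norm ?(ltW N0)// ler_pM2l.
Qed.

End estimator.

(** * The deviation bound and the two bias bounds *)

Unset Implicit Arguments.
Set Strict Implicit.
Set Printing Implicit Defensive.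

Theorem theorem13 (R : realType) (d : nat)
  (mu : {measure set (d.-tuple R) -> \bar R}) (Hmu : is_lebesgue_Rd mu)
  (f : d.-tuple R -> R) (mf : measurable_fun setT f)
  (bf : exists M : R, forall x, cube x -> `| f x | <= M)
  (N : nat) (HN : (0 < N)%N)
  (Pt : R -> probability (d.-tuple R) R)
  (Pt_on_cube : forall b : R, unit_itv b -> Pt b cube = 1%E)
  (Pt_meas : forall B : set (d.-tuple R), measurable B ->
     measurable_fun unit_itv (Pt ^~ B))
  (dO : measure_display) (Omega : measurableType dO) (P : probability Omega R)
  (beta : 'I_N -> Omega -> R) (X : 'I_N -> Omega -> d.-tuple R)
  (mbeta : forall i, measurable_fun setT (beta i))
  (mX : forall i, measurable_fun setT (X i))
  (law : forall (i : 'I_N) (A : set R) (B : set (d.-tuple R)),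
     measurable A -> measurable B ->
     P (beta i @^-1` A `&` X i @^-1` B) =
       (\int[lebesgue_measure]_(b in A `&` unit_itv) Pt b B)%E)
  (indep : mutually_independent P (fun i w => (beta i w, X i w)))
  (delta : R) (Hdelta : 0 < delta) :
  let Lt := fun w => N%:R^-1 * \sum_(i < N) f (X i w) in
  let Lf := Lpart mu f in
  let gap := `| Lf - fine (\int[P]_w (Lt w)%:E)%E | in
  [/\ ((1 - delta)%:E <=
        P [set w | (`| Lt w - Lf | <=
             gap + 2 * supnorm f * Num.sqrt (ln (2 / delta) / (2 * N%:R)))%R])%E,
      (gap%:E <= (2 * supnorm f)%R%:E *
        ereal_sup [set dTV (gibbs mu (fun x => (b * f x)%R)) (Pt b) | b in unit_itv])%E
    & lipschitz_on_cube f ->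
      (gap%:E <= (lipconst f)%:E *
        ereal_sup [set W1 (gibbs mu (fun x => (b * f x)%R)) (Pt b) | b in unit_itv])%E].
Proof.
move=> Lt Lf gap.
have mcube := @measurable_cube R d.
have mucube := lebesgue_cube Hmu.
(* All estimates are made for [fc]; f may be unbounded off the cube, where samples fall with
   probability 0. *)
pose fc := f \_ cube.
have fcM := cube_restrict_le_supnorm bf.
have mfc : measurable_fun setT fc.
  by apply/(measurable_restrictT _ mcube); exact: measurable_funS mf.
have bfc : bounded_measurable fc by split=> //; exists (supnorm f).
have lawX i B : measurable B ->
    P (X i @^-1` B) = (\int[lebesgue_measure]_(b in unit_itv) Pt b B)%E.
  by move=> mB; have := law i setT B measurableT mB; rewrite preimage_setT !setTI.
pose m := \int[lebesgue_measure]_(b in unit_itv) \int[Pt b]_x fc x.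
have EX i : \int[P]_w fc (X i w) = m by apply: expectation_mixture => // B; exact: lawX.
(* Independence is given for the pairs, so concentration is applied to the function [g] of a pair
   that reads only the sample. *)
pose Y i w := (beta i w, X i w).
have mY i : measurable_fun setT (Y i) by exact: measurable_fun_pair.
pose g (z : R * d.-tuple R) := fc z.2.
have mg : measurable_fun setT g by exact: measurableT_comp.
have gM z : `|g z| <= supnorm f by exact: fcM.
pose Lc w := N%:R^-1 * \sum_(i < N) fc (X i w).
have ELc : \int[P]_w Lc w = m := expectation_mean HN mY mg gM EX.
(* The null event that some sample leaves the cube; off it the estimators for f and [fc]
   coincide. *)
pose N0 := \big[setU/set0]_(i < N) (X i @^-1` (~` cube)).
have mout i : measurable (X i @^-1` (~` cube)).
  by rewrite -[X in measurable X]setTI; apply: mX => //; exact: measurableC.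
have mN0 : measurable N0 by exact: bigsetU_measurable.
have PN0 : P N0 = 0%E.
  apply: (proj1 (negligibleP P mN0)); rewrite /N0; elim/big_ind : _ => [||i _].
  - exact: negligible_set0.
  - by move=> A B; exact: negligibleU.
  - apply: (proj2 (negligibleP P (mout i))); rewrite [LHS](lawX i)//; last exact: measurableC.
    apply: integral0_eq => b b01.
    by rewrite [LHS]probability_setC// Pt_on_cube// subee.
have LtLc w : ~ N0 w -> Lt w = Lc w.
  move=> wN0; congr (_ * _); apply: eq_bigr => i _.
  rewrite /fc cube_restrictE//; apply: contrapT => Xw; apply: wN0.
  by rewrite /N0 (bigD1 i)//=; left.
have mLt : measurable_fun setT Lt.
  apply: measurable_funM => //; apply: measurable_sum => i.
  exact: measurableT_comp.
have mLc : measurable_fun setT Lc.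
  apply: measurable_funM => //; apply: measurable_sum => i.
  exact: measurableT_comp.
have gapE : gap = `|Lpart mu fc - m|.
  rewrite /gap /Lf (Lpart_restrict f) -ELc; congr `|_ - fine _|.
  apply: ae_eq_integral => //; [exact/measurable_EFinP..|].
  exists N0; split=> // w /= H; apply: contrapT => wN0; apply: H => _.
  by rewrite LtLc.
split.
- set t := 2 * supnorm f * _; pose A := [set w | `|Lc w - m| <= t].
  set B := [set w | _].
  have mA : measurable A.
    have -> : A = setT `&` (fun w => Lc w - m) @^-1` `[- t, t].
      by rewrite setTI; apply/seteqP; split=> w /=; rewrite in_itv/= -ler_norml.
    have mL : measurable_fun setT (fun w => Lc w - m) by exact: measurable_funB.
    exact: mL.
  have mB : measurable B.
    have -> : B = setT `&` (fun w => Lt w - Lf) @^-1` `[- (gap + t), gap + t].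
      by rewrite setTI; apply/seteqP; split=> w /=; rewrite in_itv/= -ler_norml.
    have mL : measurable_fun setT (fun w => Lt w - Lf) by exact: measurable_funB.
    exact: mL.
  (* Triangle inequality through the mean m, whose distance to [Lf] is [gap]. *)
  have AB : A `<=` B `|` N0.
    move=> w /= Aw; have [wN0|wN0] := pselect (N0 w); [by right|left].
    rewrite /B /= LtLc// gapE /Lf (Lpart_restrict f) -(subrK m (Lc w)) -addrA addrC.
    by rewrite (le_trans (ler_normD _ _))// distrC lerD.
  apply: (le_trans (hoeffding_mean HN mY indep mg gM EX Hdelta)).
  rewrite -[leRHS]adde0 -PN0; apply: le_trans (measureU2 _ _ _) => //.
  by apply: le_measure; rewrite ?inE//; exact: measurableU.
- rewrite gapE; apply: log_partition_gap => // b b01.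
  apply: (le_trans (gibbs_mean_dTV mucube bfc b (Pt b) fcM)).
  rewrite -gibbs_restrict; apply: lee_wpmul2l; first by rewrite lee_fin mulr_ge0// supnorm_ge0.
  by apply: ereal_sup_ubound; exists b.
- move=> flip; have [L0 fL] := lipconstP flip.
  rewrite gapE; apply: log_partition_gap => // b b01.
  have fcL x y : cube x -> cube y -> `|fc x - fc y| <= lipconst f * eucl x y.
    by move=> xc yc; rewrite /fc !cube_restrictE// fL.
  apply: (le_trans (gibbs_mean_W1 mucube bfc (cube_restrict_out f) b (Pt_on_cube b b01) L0 fcL)).
  rewrite -gibbs_restrict; apply: lee_wpmul2l; first by rewrite lee_fin.
  by apply: ereal_sup_ubound; exists b.
Qed.
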